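(* The functors $\mathscr{S}:\mathbf{spol}_{\bullet/s}\to\mathbf{SIM}_\bullet$ and $\mathscr{C}_s:\mathbf{SIM}_\bullet\to\mathbf{spol}_{\bullet/s}$ form an equivalence of categories (that is, they are quasi-inverse to each other).
   Context: A p-site is a triple $\mathbf{a}=(I,A,(A_i)_{i\in I})$ with $I$ a finite set (the base), $A$ a set (the ground), and $A_i\subset A$ for each $i\in I$. Its parting function is $\pi_{\mathbf{a}}:A\to\mathcal{P}(I)$, $\pi_{\mathbf{a}}(a)=\{i\in I:a\in A_i\}$, and its Nerve is $\sigma_{\mathbf{a}}=\{s\subset I:s\neq\emptyset,\ \exists a\in A,\ s\subset\pi_{\mathbf{a}}(a)\}$. Its effective ground is $A_\ast=\bigcup_{i\in I}A_i$ and its effective p-site is $\mathbf{a}_\ast=(I,A_\ast,(A_i)_{i\in I})$. For a function $\varphi:I\to J$, $\hat\varphi:\mathcal{P}(I)\to\mathcal{P}(J)$ is $\hat\varphi(s)=\{\varphi(i):i\in s\}$. Given p-sites $\mathbf{a}=(I,A,(A_i))$ and $\mathbf{b}=(J,B,(B_j))$, an S-map $\mathbf{a}\to\mathbf{b}$ is a pair $(\varphi,f)$ of functions $\varphi:I\to J$, $f:A\to B$ with $\bigcup_{i\in\varphi^{-1}(j)}A_i\subset f^{-1}(B_j)$ for all $j\in J$. The category $\mathbf{spol}_\bullet$ has p-sites as objects, and its morphisms $\mathbf{a}\to\mathbf{b}$ are the S-maps $(\varphi,f_\ast)$ from $\mathbf{a}_\ast$ to $\mathbf{b}_\ast$ (only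 the effective part of the ground matters). Category $\mathbf{spol}_{\bullet/s}$: objects are p-sites; a morphism $\mathbf{a}\to\mathbf{b}$ is a function $\varphi:I\to J$ for which there exists $f_\ast:A_\ast\to B_\ast$ such that $(\varphi,f_\ast)$ is an S-map $\mathbf{a}_\ast\to\mathbf{b}_\ast$; equivalently, $\mathbf{spol}_{\bullet/s}(\mathbf{a},\mathbf{b})=\{\varphi\in J^I:\hat\varphi(\sigma_{\mathbf{a}})\subset\sigma_{\mathbf{b}}\}$ (where $\hat\varphi(\sigma_{\mathbf a})=\{\hat\varphi(s):s\in\sigma_{\mathbf a}\}$). Composition is composition of functions and identities are $id_I$. Category $\mathbf{SIM}_\bullet$: objects are pairs $(I,\mathcal{E})$ with $I$ a finite set and $\mathcal{E}$ an $I$-simplicial complex, i.e. a set of nonempty subsets of $I$ closed under taking nonempty subsets (not every singleton need be in $\mathcal{E}$, and $\mathcal{E}$ may be empty); a morphism $(I,\mathcal{E})\to(J,\mathcal{F})$ is a function $\varphi:I\to J$ with $\hat\varphi(s)\in\mathcal{F}$ for all $s\in\mathcal{E}$. The functor $\mathscr{S}$ sends $\mathbf{a}$ to $(I,\sigma_{\mathbf{a}})$ and $\varphi$ to $\varphi$. The functor $\mathscr{C}_s$ sends $(I,\mathcal{X})$ to the canonical p-site $\mathbf{ca}(I,\mathcal{X})$ with base $I$, ground $\mathcal{X}$ and profile $\mathcal{X}_i=\{s\in\mathcal{X}:i\in s\}$ ($i\in I$), and sends $\varphi$ to $\varphi$. *)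

(* Defs.v *)
From mathcomp Require Import all_boot.
From mathcomp Require Import boolp classical_sets.

Set Implicit Arguments.
Unset Strict Implicit.
Unset Printing Implicit Defensive.

Local Open Scope classical_set_scope.
#[local] Obligation Tactic := idtac.

(* Composition is written in applicative order: [compm g f] is "g after f". *)
Record category := Category {
  obj : Type;
  hom : obj -> obj -> Type;
  idm : forall x, hom x x;
  compm : forall x y z, hom y z -> hom x y -> hom x z;
  comp_idl : forall x y (f : hom x y), compm (idm y) f = f;
  comp_idr : forall x y (f : hom x y), compm f (idm x) = f;
  comp_assoc : forall x y z t (h : hom z t) (g : hom y z) (f : hom x y),
    compm h (compm g f) = compm (compm h g) f
}.
Arguments hom : clear implicits.
Arguments idm : clear implicits.

Record functor (C D : category) := Functor {
  fobj : obj C -> obj D;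
  fmap : forall x y, hom C x y -> hom D (fobj x) (fobj y);
  fmap_id : forall x, fmap (idm C x) = idm D (fobj x);
  fmap_comp : forall x y z (g : hom C y z) (f : hom C x y),
    fmap (compm g f) = compm (fmap g) (fmap f)
}.

Program Definition id_functor (C : category) : functor C C :=
  @Functor C C (fun x => x) (fun x y f => f) _ _.
Next Obligation. by []. Qed.
Next Obligation. by []. Qed.

Program Definition comp_functor (C D E : category)
    (G : functor D E) (F : functor C D) : functor C E :=
  @Functor C E (fun x => fobj G (fobj F x)) (fun x y f => fmap G (fmap F f)) _ _.
Next Obligation. by move=> C D E G F x /=; rewrite !fmap_id. Qed.
Next Obligation. by move=> C D E G F x y z g f /=; rewrite !fmap_comp. Qed.

Definition is_iso (C : category) (x y : obj C) (f : hom C x y) : Prop :=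
  exists g : hom C y x, compm g f = idm C x /\ compm f g = idm C y.

Definition natural (C D : category) (F G : functor C D)
    (eta : forall x, hom D (fobj F x) (fobj G x)) : Prop :=
  forall (x y : obj C) (f : hom C x y),
    compm (eta y) (fmap F f) = compm (fmap G f) (eta x).

Definition naturally_isomorphic (C D : category) (F G : functor C D) : Prop :=
  exists eta : forall x, hom D (fobj F x) (fobj G x),
    natural eta /\ forall x, is_iso (eta x).

Definition quasi_inverse (C D : category)
    (F : functor C D) (G : functor D C) : Prop :=
  naturally_isomorphic (comp_functor G F) (id_functor C) /\
  naturally_isomorphic (comp_functor F G) (id_functor D).

Record psite := PSite {
  base : finType;
  ground : Type;
  part : base -> set ground
}.

(* Subsets of the finite base are [{set _}], hence decidable; the membership
   conditions, which live in [Prop], are reflected classically by [`[< >]]. *)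
Definition parting (a : psite) (x : ground a) : {set base a} :=
  [set i | `[< part i x >]]%SET.

Definition nerve (a : psite) : {set {set base a}} :=
  [set s : {set base a} |
    (s != finset.set0) && `[< exists x : ground a, s \subset parting x >]]%SET.

Definition effective_ground (a : psite) : Type :=
  {x : ground a | (\bigcup_(i in [set: base a]) part i) x}.

(* [base (effective a)] is convertible to [base a], so a map of bases is also a
   map of the bases of the effective p-sites. *)
Definition effective (a : psite) : psite :=
  @PSite (base a) (effective_ground a) (fun i => [set x | part i (sval x)]).

Definition is_smap (a b : psite)
    (phi : base a -> base b) (f : ground a -> ground b) : Prop :=
  forall j : base b,
    \bigcup_(i in phi @^-1` [set j]) part i `<=` f @^-1` (part j).

Definition spol_s_mor (a b : psite) (phi : base a -> base b) : Prop :=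
  exists f : ground (effective a) -> ground (effective b),
    @is_smap (effective a) (effective b) phi f.

Definition spol_s_hom (a b : psite) : Type :=
  {phi : base a -> base b | spol_s_mor phi}.

Lemma spol_s_id_subproof (a : psite) : @spol_s_mor a a (fun i => i).
Proof. by exists id => j x [i /= ->]. Qed.

Lemma spol_s_comp_subproof (a b c : psite)
    (psi : base b -> base c) (phi : base a -> base b) :
  spol_s_mor psi -> spol_s_mor phi -> spol_s_mor (psi \o phi).
Proof.
move=> [g gP] [f fP]; exists (g \o f) => k x [i /= ik ix].
by apply: gP; exists (phi i) => //; apply: fP; exists i.
Qed.

Definition spol_s_id (a : psite) : spol_s_hom a a :=
  exist _ (fun i => i) (spol_s_id_subproof a).

Definition spol_s_comp (a b c : psite)
    (psi : spol_s_hom b c) (phi : spol_s_hom a b) : spol_s_hom a c :=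
  exist _ (sval psi \o sval phi) (spol_s_comp_subproof (svalP psi) (svalP phi)).

Program Definition spol_s : category :=
  @Category psite spol_s_hom spol_s_id spol_s_comp _ _ _.
Next Obligation. by move=> a b [phi phiP]; apply: eq_exist. Qed.
Next Obligation. by move=> a b [phi phiP]; apply: eq_exist. Qed.
Next Obligation. by move=> a b c d h g f; apply: eq_exist. Qed.

Definition is_complex (I : finType) (E : {set {set I}}) : Prop :=
  (forall s, s \in E -> s != finset.set0) /\
  (forall s t : {set I}, s \in E -> t \subset s -> t != finset.set0 -> t \in E).

Record scomplex := SComplex {
  vertices : finType;
  faces : {set {set vertices}};
  faces_complex : is_complex faces
}.

Definition sim_mor (X Y : scomplex) (phi : vertices X -> vertices Y) : Prop :=
  forall s, s \in faces X -> phi @: s \in faces Y.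

Definition sim_hom (X Y : scomplex) : Type :=
  {phi : vertices X -> vertices Y | sim_mor phi}.

Lemma sim_id_subproof (X : scomplex) : @sim_mor X X (fun i => i).
Proof. by move=> s; rewrite imset_id. Qed.

Lemma sim_comp_subproof (X Y Z : scomplex)
    (psi : vertices Y -> vertices Z) (phi : vertices X -> vertices Y) :
  sim_mor psi -> sim_mor phi -> sim_mor (psi \o phi).
Proof. by move=> psiP phiP s sX; rewrite imset_comp; exact/psiP/phiP. Qed.

Definition sim_id (X : scomplex) : sim_hom X X :=
  exist _ (fun i => i) (@sim_id_subproof X).

Definition sim_comp (X Y Z : scomplex)
    (psi : sim_hom Y Z) (phi : sim_hom X Y) : sim_hom X Z :=
  exist _ (sval psi \o sval phi) (sim_comp_subproof (svalP psi) (svalP phi)).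

Program Definition sim : category :=
  @Category scomplex sim_hom sim_id sim_comp _ _ _.
Next Obligation. by move=> a b [phi phiP]; apply: eq_exist. Qed.
Next Obligation. by move=> a b [phi phiP]; apply: eq_exist. Qed.
Next Obligation. by move=> a b c d h g f; apply: eq_exist. Qed.

Lemma nerve_complex (a : psite) : is_complex (nerve a).
Proof.
split=> [s|s t]; rewrite !inE; first by case/andP.
case/andP=> _ /asboolP[x sx] ts -> /=; apply/asboolP.
by exists x; apply: fintype.subset_trans ts sx.
Qed.

Definition nerve_obj (a : psite) : scomplex := SComplex (nerve_complex a).

Lemma nerve_mor (a b : psite) (phi : base a -> base b) :
  spol_s_mor phi -> @sim_mor (nerve_obj a) (nerve_obj b) phi.
Proof.
move=> [f fP] s /=; rewrite !inE => /andP[/set0Pn[i0 i0s] /asboolP[x /fintype.subsetP sx]].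
have sxP i : i \in s -> part i x by move=> /sx; rewrite inE => /asboolP.
have xP : (\bigcup_(i in [set: base a]) part i) x by exists i0 => //; exact: sxP.
apply/andP; split; first by apply/set0Pn; exists (phi i0); apply: imset_f.
apply/asboolP; exists (sval (f (exist _ x xP))); apply/fintype.subsetP => j.
case/imsetP=> i si ->; rewrite inE; apply/asboolP.
by apply: (fP (phi i)); exists i => //=; apply: sxP.
Qed.

Definition nerve_map (a b : psite) (phi : hom spol_s a b) :
    hom sim (nerve_obj a) (nerve_obj b) :=
  exist _ (sval phi) (nerve_mor (svalP phi)).

Program Definition S_functor : functor spol_s sim :=
  @Functor spol_s sim nerve_obj nerve_map _ _.
Next Obligation. by move=> a; apply: eq_exist. Qed.
Next Obligation. by move=> a b c g f; apply: eq_exist. Qed.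

Definition canonical_psite (X : scomplex) : psite :=
  let face := {s : {set vertices X} | s \in faces X} in
  @PSite (vertices X) face (fun i => [set s : face | i \in sval s]).

Lemma canonical_mor (X Y : scomplex) (phi : vertices X -> vertices Y) :
  sim_mor phi -> @spol_s_mor (canonical_psite X) (canonical_psite Y) phi.
Proof.
move=> phiP.
have fP (s : ground (canonical_psite X)) :
    (\bigcup_(i in [set: vertices Y]) @part (canonical_psite Y) i)
      (exist _ (phi @: sval s) (phiP _ (svalP s))).
  have /set0Pn[i si] := (faces_complex X).1 _ (svalP s).
  by exists (phi i) => //=; apply: imset_f.
exists (fun s => exist _ _ (fP (sval s))) => j s [i /= <- si].
exact: imset_f.
Qed.

Definition canonical_map (X Y : scomplex) (phi : hom sim X Y) :
    hom spol_s (canonical_psite X) (canonical_psite Y) :=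
  exist _ (sval phi) (canonical_mor (svalP phi)).

Program Definition Cs_functor : functor sim spol_s :=
  @Functor sim spol_s canonical_psite canonical_map _ _.
Next Obligation. by move=> a; apply: eq_exist. Qed.
Next Obligation. by move=> a b c g f; apply: eq_exist. Qed.

(* Main.v *)
(** A function on bases underlies a morphism of p-sites exactly when it maps
    nerve to nerve: an effective point is sent to any point whose parting
    contains the image of its own parting.  Hence [nerve] is fully faithful;
    since the nerve of the canonical p-site of a complex is that complex, both
    natural isomorphisms are the identity on vertices. *)

Require Import Defs.
From mathcomp Require Import all_boot.
From mathcomp Require Import boolp classical_sets.

Lemma spol_s_mor_nerve (a b : psite) (phi : base a -> base b) :
  @sim_mor (nerve_obj a) (nerve_obj b) phi -> spol_s_mor phi.
Proof.
move=> phiP.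
have ex_image (x : effective_ground a) : exists y : effective_ground b,
    forall i, part i (sval x) -> part (phi i) (sval y).
  case: x => x [i0 _ xi0] /=.
  (* Effectiveness of [x] enters here: [i0] makes its parting nonempty, hence a face of the
     nerve. *)
  have xN : parting x \in nerve a.
    rewrite inE; apply/andP; split; last by apply/asboolP; exists x.
    by apply/set0Pn; exists i0; rewrite inE; apply/asboolP.
  have := phiP _ xN; rewrite inE => /andP[_ /asboolP[y /fintype.subsetP sub]].
  have yP i : part i x -> part (phi i) y.
    move=> xi; have: phi i \in parting y.
      by apply: sub; apply: imset_f; rewrite inE; apply/asboolP.
    by rewrite inE => /asboolP.
  by unshelve eexists (exist _ y _) => //; exists (phi i0); [|exact: yP].
have [f fP] := choice ex_image.
by exists f => j x [i /= <-]; exact: fP.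
Qed.

(** A face [t], taken as a point of the canonical p-site, has parting [t] itself, so the nerve
    consists of the nonempty subsets of faces, and a complex is closed under these. *)
Lemma nerve_canonical (X : scomplex) : nerve (canonical_psite X) = faces X.
Proof.
have [faces_neq0 faces_sub] := faces_complex X.
apply/setP => s; rewrite inE; apply/andP/idP => [[s0 /asboolP[[t tX] st]]|sX].
  apply: (faces_sub t) => //; apply/fintype.subsetP => i /(fintype.subsetP st).
  by rewrite inE => /asboolP.
split; first exact: faces_neq0.
apply/asboolP; exists (exist _ s sX); apply/fintype.subsetP => i si.
by rewrite inE; apply/asboolP.
Qed.

(** Both p-sites have the same nerve, so the identity of the base is a morphism in each direction,
    although the grounds may differ. *)
Lemma canonical_nerve_to_mor (a : psite) :
  @spol_s_mor (canonical_psite (nerve_obj a)) a (fun i => i).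
Proof.
by apply: spol_s_mor_nerve => s /=; rewrite nerve_canonical imset_id.
Qed.

Lemma canonical_nerve_from_mor (a : psite) :
  @spol_s_mor a (canonical_psite (nerve_obj a)) (fun i => i).
Proof.
by apply: spol_s_mor_nerve => s /=; rewrite nerve_canonical imset_id.
Qed.

Lemma nerve_canonical_to_mor (X : scomplex) :
  @sim_mor (nerve_obj (canonical_psite X)) X (fun i => i).
Proof. by move=> s /=; rewrite nerve_canonical imset_id. Qed.

Lemma nerve_canonical_from_mor (X : scomplex) :
  @sim_mor X (nerve_obj (canonical_psite X)) (fun i => i).
Proof. by move=> s /=; rewrite nerve_canonical imset_id. Qed.

Theorem theorem5p2p8 : quasi_inverse S_functor Cs_functor.
Proof.
split.
- exists (fun a => exist _ _ (canonical_nerve_to_mor a)).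
  (* Naturality reduces to equality of the underlying functions, as proofs of the morphism
     conditions are irrelevant. *)
  split=> [a b f|a]; first exact: eq_exist.
  by exists (exist _ _ (canonical_nerve_from_mor a)); split; apply: eq_exist.
- exists (fun X => exist _ _ (nerve_canonical_to_mor X)).
  split=> [X Y f|X]; first exact: eq_exist.
  by exists (exist _ _ (nerve_canonical_from_mor X)); split; apply: eq_exist.
Qed.
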